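(* Let $a,b,n$ be positive integers with $a>b$, and define \[ T_0(an,bn,q)'=\sum_{k=an-bn-\lfloor n/2\rfloor}^{an-bn}(-1)^k\begin{bmatrix} an\\ k\end{bmatrix}_{q^2}\begin{bmatrix} 2an-2k\\ an-bn-k\end{bmatrix}. \] Then \[ T_0(an,bn,q)'\equiv(-1)^{an-bn}\begin{bmatrix} an\\ bn\end{bmatrix}_{q^2}\Big\{1-2(a-b)\big(1-\theta_n(q)\big)\Big\}\pmod{\Phi_n(q)^2}, \] where \[ \theta_n(q)=\begin{cases} (-1)^m(1+q^m)q^{m(3m-1)/2}, &\text{if } n=3m,\\ (-1)^mq^{m(3m+1)/2}, &\text{if } n=3m+1,\\ (-1)^{m+1}q^{(m+1)(3m+2)/2}, &\text{if } n=3m+2.\end{cases} \]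
   Context: For integers $n,m$, the $q$-binomial coefficient is $\begin{bmatrix} n\\ m\end{bmatrix}_q=\begin{bmatrix} n\\ m\end{bmatrix}=\frac{(1-q^n)(1-q^{n-1})\cdots(1-q^{n-m+1})}{(1-q)(1-q^2)\cdots(1-q^m)}$ if $0\le m\le n$, and $0$ otherwise; $\begin{bmatrix} n\\ m\end{bmatrix}_{q^2}$ is the same with $q$ replaced by $q^2$. $\Phi_n(q)$ denotes the $n$-th cyclotomic polynomial. $\lfloor x\rfloor$ is the integer part of $x$. For rational functions $A(q),B(q)$, $A\equiv B\pmod{\Phi_n(q)^2}$ means $A-B=\Phi_n(q)^2P(q)/Q(q)$ with $P,Q\in\mathbb{Z}[q]$ and $Q$ coprime to $\Phi_n(q)$. *)

(* Defs.v *)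
From mathcomp Require Import all_boot all_order all_algebra all_field.

Set Implicit Arguments.
Unset Strict Implicit.
Unset Printing Implicit Defensive.

Import GRing.Theory.

Local Open Scope ring_scope.

(* The field Q(q), as the fraction field of Z[q], and its indeterminate. *)
Definition ratfun := {fraction {poly int}}.

Definition qvar : ratfun := tofrac 'X.

(* The q-binomial coefficient with base x: [qbinom qvar n m] is the usual one
   and [qbinom (qvar ^+ 2) n m] the one in which q is replaced by q^2. *)
Definition qbinom (F : fieldType) (x : F) (n m : nat) : F :=
  if (m <= n)%N then
    (\prod_(0 <= i < m) (1 - x ^+ (n - i))) /
    (\prod_(1 <= i < m.+1) (1 - x ^+ i))
  else 0.

(* [coprimep] over Z is coprimality in Q[q]; as D is applied only to a
   cyclotomic polynomial, which is monic, it is also coprimality in Z[q].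
   It excludes Q = 0 as soon as D is not constant. *)
Definition eqmod_sqr (D : {poly int}) (A B : ratfun) : Prop :=
  exists P Q : {poly int},
    coprimep Q D /\ A - B = tofrac D ^+ 2 * (tofrac P / tofrac Q).

(* T_0(an,bn,q)'.  It depends on n itself, through floor(n/2), and not only on
   the products an and bn.  No natural-number subtraction below truncates when
   0 < b < a and 0 < n. *)
Definition T0' (a b n : nat) : ratfun :=
  \sum_(a * n - b * n - n %/ 2 <= k < (a * n - b * n).+1)
    (-1) ^+ k * qbinom (qvar ^+ 2) (a * n) k
      * qbinom qvar (2 * a * n - 2 * k) (a * n - b * n - k).

(* The products halved below are always even. *)
Definition theta (n : nat) : ratfun :=
  let m := (n %/ 3)%N in
  match (n %% 3)%N with
  | 0 => (-1) ^+ m * (1 + qvar ^+ m) * qvar ^+ (m * (3 * m - 1) %/ 2)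
  | 1 => (-1) ^+ m * qvar ^+ (m * (3 * m + 1) %/ 2)
  | _ => (-1) ^+ m.+1 * qvar ^+ (m.+1 * (3 * m + 2) %/ 2)
  end.

(* Main.v *)
(* Reversing the order of summation by k = an - bn - j, the j = 0 term of T_0' is
   (-1)^(an-bn) [an; bn]_{q^2}, and the ratio of the j-th term to it carries, for
   1 <= j <= n/2, the factor 1 - q^(2(a-b)n), which is 2(a-b)(1 - q^n) modulo
   Phi_n(q)^2.  The cofactor therefore matters only modulo Phi_n(q); putting
   q^n = 1 there turns it, factor by factor, into that of the j-th term of

     theta_n(q) = sum_{0 <= j <= n/2} (-1)^j q^(j(j-1)/2)
                    (1 - q^n)/(1 - q^(n-j)) [n-j; j].

   This closed form follows from theta_n = E_n - q^(n-1) E_(n-2), where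
   E_n = sum_j (-1)^j q^(j(j-1)/2) [n-j; j]: the two q-Pascal rules, played against
   each other, give the three-step recurrence E_(n+3) = - q^(n+1) E_n. *)
Require Import Defs.
From mathcomp Require Import all_boot all_order all_algebra all_field.
From mathcomp Require Import ring zify.
Import GRing.Theory.
Local Open Scope ring_scope.

Set Implicit Arguments.
Unset Strict Implicit.
Unset Printing Implicit Defensive.

(** * q-Pascal rules and the alternating sums E_n *)

(** Falling product in which the subtraction truncates: for k > n the factor of index n is 1 - x^0 =
    0, so the quotient formula [qbinomE] needs no bound on k. *)
Definition qffact (F : fieldType) (x : F) (n k : nat) : F :=
  \prod_(i < k) (1 - x ^+ (n - i)).

Definition qpoch (F : fieldType) (x : F) (k : nat) : F :=
  \prod_(i < k) (1 - x ^+ i.+1).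

(* E_n of the header is the case s = 0; the case s = 1 is needed to close the
   recurrence. *)
Definition qfib (F : fieldType) (x : F) (s n : nat) : F :=
  \sum_(k < n.+1) (-1) ^+ k * x ^+ 'C(k + s, 2) * qbinom x (n - k) k.

Section QBinomial.
Variables (F : fieldType) (x : F).
Hypothesis x_nroot : forall i, 1 - x ^+ i.+1 != 0.

Lemma qpoch_neq0 k : qpoch x k != 0.
Proof. by apply/prodf_neq0 => i _; apply: x_nroot. Qed.

Lemma qpochS k : qpoch x k.+1 = qpoch x k * (1 - x ^+ k.+1).
Proof. by rewrite /qpoch big_ord_recr. Qed.

Lemma qffact_small n k : (n < k)%N -> qffact x n k = 0.
Proof.
move=> lt_nk; rewrite /qffact (bigD1 (Ordinal lt_nk)) //=.
by rewrite subnn expr0 subrr mul0r.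
Qed.

Lemma qffactSS n k : qffact x n.+1 k.+1 = (1 - x ^+ n.+1) * qffact x n k.
Proof. by rewrite /qffact big_ord_recl subn0. Qed.

Lemma qffactSr n k : qffact x n k.+1 = qffact x n k * (1 - x ^+ (n - k)).
Proof. by rewrite /qffact big_ord_recr. Qed.

Lemma qbinomE n k : qbinom x n k = qffact x n k / qpoch x k.
Proof.
rewrite /qbinom; case: leqP => [_|/qffact_small->]; last by rewrite mul0r.
by rewrite big_mkord big_add1 big_mkord.
Qed.

Lemma qbinom0 n : qbinom x n 0 = 1.
Proof. by rewrite qbinomE /qffact /qpoch !big_ord0 divr1. Qed.

Lemma qbinom_small n k : (n < k)%N -> qbinom x n k = 0.
Proof. by move=> lt_nk; rewrite /qbinom leqNgt lt_nk. Qed.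

Lemma qbinomS n k :
  qbinom x n.+1 k.+1 = x ^+ k.+1 * qbinom x n k.+1 + qbinom x n k.
Proof.
have [le_kn|lt_nk] := leqP k n; last first.
  by rewrite !qbinom_small ?mulr0 ?addr0 // ltnS // ltnW.
rewrite !qbinomE qffactSS qffactSr qpochS.
(* Both sides become rational in the two independent powers x^(k+1) and x^(n-k). *)
have -> : n.+1 = (k.+1 + (n - k))%N by lia.
rewrite exprD; field.
by rewrite qpoch_neq0 x_nroot.
Qed.

Lemma qbinomS_r n k :
  qbinom x n.+1 k.+1 = qbinom x n k.+1 + x ^+ (n - k) * qbinom x n k.
Proof.
have [le_kn|lt_nk] := leqP k n; last first.
  by rewrite !qbinom_small ?mulr0 ?addr0 // ltnS // ltnW.
rewrite !qbinomE qffactSS qffactSr qpochS.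
have -> : n.+1 = (k.+1 + (n - k))%N by lia.
rewrite exprD; field.
by rewrite qpoch_neq0 x_nroot.
Qed.

(** Applied to the term of index k+1, the q-Pascal rule with weight x^(k+1) raises 'C(k+1, 2) to
    'C(k+2, 2) in one summand and leaves it in the other; both exponents fit the shift s = 1. *)
Lemma qfib0_rec n : qfib x 0 n.+2 = qfib x 1 n.+1 - qfib x 1 n.
Proof.
rewrite /qfib big_ord_recl [in RHS]big_ord_recl big_ord_recr /=.
rewrite !subn0 !qbinom0 qbinom_small ?mulr0 ?addr0; last by rewrite /bump; lia.
rewrite -addrA; congr (_ + _).
rewrite -sumrB; apply: eq_bigr => k _.
have le_kn : (k <= n)%N by rewrite -ltnS.
rewrite /= /bump /= !add1n subSS subSn // qbinomS subSS addn0 !addn1.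
rewrite (binS k.+1 1) bin1 exprD.
move: (qbinom _ _ _) (qbinom _ _ _) => u v.
by rewrite (exprS (-1)); ring.
Qed.

(** The other q-Pascal rule has weight x^(n-2k), and 'C(k+2, 2) + n - 2k = 'C(k, 2) + n + 1, which
    leads back to s = 0 with a factor independent of k. *)
Lemma qfib1_rec n : qfib x 1 n.+2 = qfib x 1 n.+1 - x ^+ n.+1 * qfib x 0 n.
Proof.
rewrite /qfib big_ord_recl [in RHS]big_ord_recl big_ord_recr /=.
rewrite !subn0 !qbinom0 qbinom_small ?mulr0 ?addr0; last by rewrite /bump; lia.
rewrite -addrA; congr (_ + _).
rewrite mulr_sumr -sumrB; apply: eq_bigr => k _.
have le_kn : (k <= n)%N by rewrite -ltnS.
rewrite /= /bump /= !add1n subSS subSn // qbinomS_r subSS addn0 addn1.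
(* For n < 2k the truncated exponent n - k - k would be wrong, but the q-binomial next to it
   vanishes. *)
have [lt|le2] := ltnP (n - k) k; first by rewrite (@qbinom_small _ k) //; ring.
have : x ^+ 'C(k.+2, 2) * x ^+ (n - k - k) = x ^+ n.+1 * x ^+ 'C(k, 2).
  by rewrite -!exprD !binS bin1 bin0; congr (x ^+ _); lia.
move: (x ^+ (n - k - k)) (x ^+ n.+1) (qbinom _ _ _) (qbinom _ _ _) => y z v u e.
have -> : z * ((-1) ^+ k * x ^+ 'C(k, 2) * v) = (-1) ^+ k * (z * x ^+ 'C(k, 2)) * v.
  by ring.
by rewrite -e exprS; ring.
Qed.

Lemma qfib_rec n : qfib x 0 n.+3 = - x ^+ n.+1 * qfib x 0 n.
Proof. by rewrite qfib0_rec qfib1_rec; ring. Qed.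

Lemma qfib0_3 m :
  [/\ qfib x 0 (3 * m) = (-1) ^+ m * x ^+ (m * (3 * m - 1) %/ 2),
      qfib x 0 (3 * m).+1 = (-1) ^+ m * x ^+ (m * (3 * m + 1) %/ 2)
    & qfib x 0 (3 * m).+2 = 0].
Proof.
(* The initial values are E_0 = E_1 = 1 and E_2 = 0; the truncation of 3m - 1 at m = 0 is harmless,
   being multiplied by 0. *)
elim: m => [|m [e0 e1 e2]].
  have q11 : qbinom x 1 1 = 1.
    by rewrite qbinomS qbinom0 qbinom_small // mulr0 add0r.
  rewrite /qfib !big_ord_recl !big_ord0 /= !subn0 /bump /= !subSS !subn0 !sub0n.
  rewrite !qbinom0 q11 !(@qbinom_small 0) // !mulr0 !addr0.
  by split; rewrite ?expr0 ?expr1 ?mul1r ?mulr1 ?subrr.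
have -> : (3 * m.+1 = (3 * m).+3)%N by lia.
rewrite !qfib_rec e0 e1 e2 mulr0; split=> //.
- have -> : (m.+1 * ((3 * m).+3 - 1) %/ 2 = (3 * m).+1 + m * (3 * m - 1) %/ 2)%N.
    by nia.
  by rewrite exprD (exprS (-1)); ring.
have -> : (m.+1 * ((3 * m).+3 + 1) %/ 2 = (3 * m).+2 + m * (3 * m + 1) %/ 2)%N.
  by nia.
by rewrite exprD (exprS (-1)); ring.
Qed.
End QBinomial.

(** * The Lucas form of theta_n and the ratios of the terms of T_0' *)

(* The term of index j+1 of theta_n in the header, divided by 1 - q^n. *)
Definition lucas_coef (F : fieldType) (x : F) (n j : nat) : F :=
  (-1) ^+ j.+1 * x ^+ 'C(j.+1, 2) * qffact x (n - j.+2) j / qpoch x j.+1.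

(* For c = an - bn and with bn for b: up to sign, the ratio of the terms of index
   j+1 and 0 of T_0', divided by 1 - q^(2c). *)
Definition term_coef (F : fieldType) (x : F) (c b j : nat) : F :=
  (\prod_(i < j) ((1 - x ^+ (2 * (c - i.+1))) * (1 - x ^+ (2 * b + j.+1 + i.+1))
                  / (1 - x ^+ (2 * (b + i.+1))))) / qpoch x j.+1.

Section QLucas.
Variables (F : fieldType) (x : F).
Hypothesis x_nroot : forall i, 1 - x ^+ i.+1 != 0.

(** q-analogue of the expression of a Lucas polynomial by two Fibonacci polynomials: the weight (1 -
    x^n)/(1 - x^(n-j)) on [n-j; j] tends to n/(n-j) as x tends to 1. *)
Lemma qlucas n :
  qfib x 0 n.+2 - x ^+ n.+1 * qfib x 0 n =
    1 + (1 - x ^+ n.+2) * \sum_(j < n.+2 %/ 2) lucas_coef x n.+2 j.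
Proof.
(* The added terms have 2j > n, so their falling product contains a zero factor. *)
have -> : \sum_(j < n.+2 %/ 2) lucas_coef x n.+2 j
          = \sum_(j < n.+1) lucas_coef x n.+2 j.
  rewrite -!(big_mkord xpredT (lucas_coef x n.+2)).
  rewrite [RHS](@big_cat_nat _ _ _ (n.+2 %/ 2)) /=; [|lia|lia].
  rewrite [X in _ + X]big_nat_cond [X in _ + X]big1 ?addr0 // => j.
  rewrite andbT => /andP[lej ltj].
  by rewrite /lucas_coef qffact_small ?mulr0 ?mul0r //; lia.
rewrite /qfib big_ord_recl big_ord_recr /=.
rewrite !subn0 !(qbinom0 x) qbinom_small ?mulr0 ?addr0; last by rewrite /bump; lia.
rewrite -addrA; congr (_ + _); first by rewrite !mulr1.
rewrite !mulr_sumr -sumrB; apply: eq_bigr => k _.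
have le_kn : (k <= n)%N by rewrite -ltnS.
rewrite /= /bump /= !add1n !addn0 /lucas_coef !subSS subSn //.
move: k le_kn => [k /= _] le_kn.
rewrite !qbinomE qffactSS qpochS binS bin1 exprD.
(* Up to common factors, what remains is x^k (1 - x^(n-k+1)) + x^(n+1) (1 - x^(k+1)) = x^k (1 -
   x^(n+2)). *)
have -> : n.+2 = ((n - k).+1 + k.+1)%N by lia.
have -> : n.+1 = ((n - k).+1 + k)%N by lia.
rewrite !exprD (exprS (-1)).
have /andP[? ?] : (qpoch x k != 0) && (1 - x ^+ k.+1 != 0).
  by rewrite qpoch_neq0 // x_nroot.
move: (x_nroot k); rewrite exprS => ?.
by field; apply/andP.
Qed.

Lemma qffact_qpoch n k :
  (k <= n)%N -> qffact x n k * qpoch x (n - k) = qpoch x n.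
Proof.
elim: k => [|k IHk] le_kn; first by rewrite /qffact big_ord0 mul1r subn0.
rewrite -IHk ?(ltnW le_kn) // qffactSr -mulrA; congr (_ * _).
by rewrite -(subnSK le_kn) qpochS mulrC.
Qed.

Lemma qbinom_qpoch n k :
  (k <= n)%N -> qbinom x n k = qpoch x n / (qpoch x k * qpoch x (n - k)).
Proof.
move=> le_kn; rewrite qbinomE -(qffact_qpoch le_kn); field.
by rewrite !qpoch_neq0.
Qed.

Lemma qbinom_sub n k : (k <= n)%N -> qbinom x n (n - k) = qbinom x n k.
Proof.
move=> le_kn; rewrite !qbinom_qpoch ?leq_subr // subKn //.
by rewrite [X in _ / X]mulrC.
Qed.

Lemma qpochD b k :
  qpoch x (b + k) = qpoch x b * \prod_(i < k) (1 - x ^+ (b + i.+1)).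
Proof.
rewrite /qpoch big_split_ord /=; congr (_ * _).
by apply: eq_bigr => i _; rewrite addnS.
Qed.

End QLucas.

(** Here n and b stand for an and bn. The factor 1 - x^(2(b+j+1)) occurs in the denominator of the
    first q-binomial and in the numerator of the second. Cancelling it is essential: for n even and
    j+1 = n/2, in the original notation, it is divisible by Phi_n, whereas the denominators left in
    [term_coef] are not. *)
Lemma T0'_term (F : fieldType) (x : F) (n b j : nat) :
    (forall i, 1 - x ^+ i.+1 != 0) -> (b + j < n)%N ->
  qbinom (x ^+ 2) n (n - b - j.+1) * qbinom x (2 * n - 2 * (n - b - j.+1)) j.+1
  = qbinom (x ^+ 2) n b * ((1 - x ^+ (2 * (n - b))) * term_coef x (n - b) b j).
Proof.
move=> x_nroot lt_n.
have x2_nroot i : 1 - (x ^+ 2) ^+ i.+1 != 0.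
  by rewrite -exprM mulnS addSn x_nroot.
rewrite -subnDA qbinom_sub //; last by lia.
rewrite !(qbinom_qpoch x2_nroot); [|lia|lia].
have -> : (2 * n - 2 * (n - (b + j.+1)) = 2 * (b + j.+1))%N by lia.
set A := \prod_(i < j) (1 - x ^+ (2 * (b + i.+1))).
set B := \prod_(i < j) (1 - x ^+ (2 * (n - b - i.+1))).
set C := \prod_(i < j) (1 - x ^+ (2 * b + j.+1 + i.+1)).
have eA : qpoch (x ^+ 2) (b + j.+1)
        = qpoch (x ^+ 2) b * (A * (1 - x ^+ (2 * (b + j.+1)))).
  rewrite qpochD big_ord_recr /= exprM; congr (_ * (_ * _)).
  by apply: eq_bigr => i _; rewrite exprM.
have eB : qpoch (x ^+ 2) (n - b)
        = (1 - x ^+ (2 * (n - b))) * B * qpoch (x ^+ 2) (n - (b + j.+1)).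
  rewrite subnDA -(@qffact_qpoch _ _ (n - b) j.+1); last by lia.
  rewrite /qffact big_ord_recl subn0 -exprM; congr (_ * _ * _).
  by apply: eq_bigr => i _; rewrite exprM.
have eC : qffact x (2 * (b + j.+1)) j.+1 = (1 - x ^+ (2 * (b + j.+1))) * C.
  rewrite /qffact big_ord_recl subn0; congr (_ * _).
  rewrite (reindex_inj rev_ord_inj); apply: eq_bigr => i _ /=.
  by rewrite /bump /=; congr (_ - x ^+ _); have := ltn_ord i; lia.
have eT : term_coef x (n - b) b j = B * C / A / qpoch x j.+1.
  by rewrite /term_coef prodf_div big_split.
have nz m : (0 < m)%N -> 1 - x ^+ (2 * m) != 0.
  by case: m => // m _; rewrite mulnS x_nroot.
have A_neq0 : A != 0 by apply/prodf_neq0 => i _; rewrite nz // addnS.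
have B_neq0 : B != 0.
  by apply/prodf_neq0 => i _; rewrite nz //; have := ltn_ord i; lia.
rewrite qbinomE eA eB eC eT; field.
have lt_bn : (b < n)%N by apply: leq_ltn_trans lt_n; apply: leq_addr.
by rewrite A_neq0 B_neq0 !nz ?subn_gt0 ?addnS // !qpoch_neq0.
Qed.

(** * The local ring of Z[q] at D and the powers of D in it *)

Section Multiples.
Variable D : {poly int}.
Hypothesis D_nonconst : (1 < size D)%N.

(* The ideal generated by D^k in the localization of Z[q] at the polynomials
   coprime to D; [multiple 0] is the local ring itself. *)
Definition multiple (k : nat) (x : ratfun) : Prop :=
  exists P Q : {poly int},
    coprimep Q D /\ x = tofrac D ^+ k * (tofrac P / tofrac Q).

Lemma coprimep_tofrac_neq0 Q : coprimep Q D -> tofrac Q != 0.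
Proof.
rewrite tofrac_eq0; apply: contraTneq => ->.
by rewrite coprime0p -size_poly_eq1 neq_ltn D_nonconst orbT.
Qed.

Lemma multipleD k x y : multiple k x -> multiple k y -> multiple k (x + y).
Proof.
move=> [P [Q [cQ ->]]] [P' [Q' [cQ' ->]]].
exists (P * Q' + P' * Q), (Q * Q'); split; first by rewrite coprimepMl cQ.
by rewrite -mulrDr addf_div ?coprimep_tofrac_neq0 // -!tofracM -tofracD.
Qed.

Lemma multipleM k l x y :
  multiple k x -> multiple l y -> multiple (k + l) (x * y).
Proof.
move=> [P [Q [cQ ->]]] [P' [Q' [cQ' ->]]].
exists (P * P'), (Q * Q'); split; first by rewrite coprimepMl cQ.
by rewrite mulrACA -exprD mulf_div -!tofracM.
Qed.

Lemma multipleMl k x y : multiple 0 x -> multiple k y -> multiple k (x * y).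
Proof. exact: multipleM. Qed.

Lemma multiple_tofrac P : multiple 0 (tofrac P).
Proof. by exists P, 1; rewrite coprime1p tofrac1 divr1 mul1r. Qed.

Lemma multiple0 k : multiple k 0.
Proof. by exists 0, 1; rewrite coprime1p tofrac0 mul0r mulr0. Qed.

Lemma multiple1 : multiple 0 1.
Proof. by rewrite -tofrac1; apply: multiple_tofrac. Qed.

Lemma multipleN k x : multiple k x -> multiple k (- x).
Proof. by rewrite -mulN1r -tofrac1 -tofracN; apply/multipleMl/multiple_tofrac. Qed.

Lemma multipleB k x y : multiple k x -> multiple k y -> multiple k (x - y).
Proof. by move=> kx ky; apply/multipleD/multipleN. Qed.

Lemma multiple_sum k n (f : 'I_n -> ratfun) :
  (forall i, multiple k (f i)) -> multiple k (\sum_i f i).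
Proof.
by move=> kf; apply: big_ind => // [|x y]; [apply: multiple0|apply: multipleD].
Qed.

Lemma multiple_prod n (f : 'I_n -> ratfun) :
  (forall i, multiple 0 (f i)) -> multiple 0 (\prod_i f i).
Proof.
move=> f0; apply: big_ind => // [|x y]; last exact: multipleMl.
exact: multiple1.
Qed.

Lemma multipleV Q : coprimep Q D -> multiple 0 (tofrac Q)^-1.
Proof. by move=> cQ; exists 1, Q; rewrite cQ tofrac1 div1r mul1r. Qed.

Lemma multiple_prodB k n (f g : 'I_n -> ratfun) :
    (forall i, multiple 0 (f i)) -> (forall i, multiple 0 (g i)) ->
    (forall i, multiple k (f i - g i)) ->
  multiple k (\prod_i f i - \prod_i g i).
Proof.
elim: n f g => [|n IHn] f g f0 g0 fg.
  by rewrite !big_ord0 subrr; apply: multiple0.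
rewrite !big_ord_recr /=; set u := \prod_(i < n) _; set v := \prod_(i < n) _.
(* Telescoping: one factor is exchanged at a time. *)
have -> : u * f ord_max - v * g ord_max
        = u * (f ord_max - g ord_max) + g ord_max * (u - v) by ring.
apply: multipleD; apply: multipleMl => //; first exact: multiple_prod.
exact: IHn.
Qed.

(** The quotient formula is of no use here, since D may divide its denominators; the q-Pascal rule
    shows that the q-binomial is a polynomial in x. *)
Lemma multiple_qbinom x n k : (forall i, 1 - x ^+ i.+1 != 0) ->
  multiple 0 x -> multiple 0 (qbinom x n k).
Proof.
move=> x_nroot x0.
have xX i : multiple 0 (x ^+ i).
  elim: i => [|i IHi]; last by rewrite exprS; apply: multipleMl.
  exact: multiple1.
elim: n k => [|n IHn] [|k].
- by rewrite qbinom0; apply: multiple1.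
- by rewrite qbinom_small //; apply: multiple0.
- by rewrite qbinom0; apply: multiple1.
by rewrite qbinomS //; apply/multipleD/IHn/multipleMl/IHn.
Qed.
End Multiples.

(** * Coprimality to the cyclotomic polynomials *)

(** A gcd whose size is not 1 has a root in the algebraically closed field [algC], and this root is
    common to P and Q. *)
Lemma coprimep_intP (P Q : {poly int}) :
    (forall z : algC,
       root (map_poly intr P) z -> root (map_poly intr Q) z -> False) ->
  coprimep P Q.
Proof.
move=> no_root; rewrite coprimep_def; apply/negPn/negP.
rewrite -(size_map_inj_poly (@intr_inj algC)) // => /closed_rootP[z gz].
suff root_dvd p : gcdp P Q %| p -> root (map_poly intr p) z.
  by apply: (no_root z); apply: root_dvd; rewrite ?dvdp_gcdl ?dvdp_gcdr.
(* Over Z, divisibility holds only up to a nonzero constant c, which does not affect the roots. *)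
case/Pdiv.Idomain.dvdpP => -[c r] /= c_neq0 def_p.
have : root (map_poly (intr : int -> algC) (c *: p)) z.
  by rewrite def_p rmorphM rootM gz orbT.
by rewrite map_polyZ rootZ // intr_eq0.
Qed.

Lemma coprimep_1subXn_Cyclotomic (n i : nat) :
  (0 < n)%N -> ~~ (n %| i)%N -> coprimep (1 - 'X^i) 'Phi_n.
Proof.
move=> n_gt0 not_ni; apply: coprimep_intP => z.
have [w w_prim] := C_prim_root_exists n_gt0.
rewrite (Cintr_Cyclotomic w_prim) (root_cyclotomic w_prim) => zi z_prim.
move: zi; rewrite rmorphB rmorph1 rmorphXn /= map_polyX /root !hornerE.
by rewrite subr_eq0 eq_sym -(prim_order_dvd z_prim) (negPf not_ni).
Qed.

Lemma size_Cyclotomic_gt1 n : (0 < n)%N -> (1 < size 'Phi_n)%N.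
Proof. by move=> n_gt0; rewrite size_Cyclotomic ltnS totient_gt0. Qed.

(** * The closed form of theta_n *)

Lemma qvar_nroot i : 1 - qvar ^+ i.+1 != 0.
Proof.
rewrite /qvar -tofrac1 -tofracXn -tofracB tofrac_eq0 subr_eq0 eq_sym.
apply/eqP => /(congr1 (fun p : {poly int} => size p)).
by rewrite size_polyXn size_poly1.
Qed.

Lemma theta_qlucas n : (0 < n)%N ->
  theta n = 1 + (1 - qvar ^+ n) * \sum_(j < n %/ 2) lucas_coef qvar n j.
Proof.
case: n => // -[_|n _].
  by rewrite big_ord0 mulr0 addr0 /theta /= !mul1r expr0.
rewrite -(qlucas qvar_nroot) /theta.
have := ltn_pmod n.+2 (isT : 0 < 3)%N; have := divn_eq n.+2 3.
case: (n.+2 %% 3)%N (n.+2 %/ 3)%N => [|[|[|//]]] m def_n _ /=.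
(* If 3 divides n, both E_n and E_(n-2) survive and give the two terms of 1 + q^m. In the next case
   E_(n-2) = 0, and in the last one E_n = 0. *)
- case: m def_n => // m def_n.
  have -> : n = (3 * m).+1 by lia.
  have [_ e1 _] := qfib0_3 qvar_nroot m.
  have [e0 _ _] := qfib0_3 qvar_nroot m.+1.
  have -> : (3 * m).+3 = (3 * m.+1)%N by lia.
  rewrite e0 e1.
  have -> : (m.+1 * (3 * m.+1 - 1) %/ 2)%N
          = ((3 * m).+1 + m * (3 * m - 1) %/ 2)%N by nia.
  have -> : (m * (3 * m + 1) %/ 2)%N = (m + m * (3 * m - 1) %/ 2)%N by nia.
  rewrite !exprD (exprS _ (3 * m).+1) (exprS _ (3 * m)) (exprS (-1)) (exprS _ m).
  ring.
- case: m def_n => [|m] def_n; first by lia.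
  have -> : n = (3 * m).+2 by lia.
  have [_ _ e2] := qfib0_3 qvar_nroot m.
  have [_ e1 _] := qfib0_3 qvar_nroot m.+1.
  have -> : (3 * m).+4 = (3 * m.+1).+1 by lia.
  by rewrite e1 e2 mulr0 subr0.
- have -> : n = (3 * m)%N by lia.
  have [e0 _ e2] := qfib0_3 qvar_nroot m.
  rewrite e0 e2 sub0r.
  have -> : (m.+1 * (3 * m + 2) %/ 2)%N
          = ((3 * m).+1 + m * (3 * m - 1) %/ 2)%N by nia.
  by rewrite exprD (exprS (-1)); ring.
Qed.

(** * Congruences modulo Phi_n and its square *)

(** In the application v, s and prt are powers of q^n, so each summand of the numerator on the right
    is visibly a multiple of Phi_n. *)
Lemma term_factor_eq (F : fieldType) (p r s t v : F) : 1 - s * t != 0 ->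
  (1 - p * r * v) * (1 - p * s * t) / (1 - s * t) - p * (1 - r)
  = (1 - p * r * t * s + p * r * (1 - v) - p * (1 - v * (p * r * t) * s))
    / (1 - s * t).
Proof. by move=> nz; field. Qed.

Lemma ndvdn_double_addn n b i :
  (2 * i.+1 < n)%N -> ~~ (n %| 2 * (b * n + i.+1))%N.
Proof.
have dv : (n %| 2 * (b * n))%N by rewrite mulnA dvdn_mull.
by move=> lt_in; rewrite mulnDr (dvdn_addr _ dv) gtnNdvd ?muln_gt0.
Qed.

Section Congruences.
Variable n : nat.
Hypothesis n_gt0 : (0 < n)%N.

Local Notation multiple := (multiple 'Phi_n).
Let Phi_gt1 : (1 < size 'Phi_n)%N := size_Cyclotomic_gt1 n_gt0.

Lemma multiple_qvarX i : multiple 0 (qvar ^+ i).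
Proof. by rewrite -tofracXn; apply: multiple_tofrac. Qed.

Lemma multiple_signr i : multiple 0 ((-1) ^+ i).
Proof. by rewrite -tofrac1 -tofracN -tofracXn; apply: multiple_tofrac. Qed.

Lemma multiple_1subqX i : multiple 0 (1 - qvar ^+ i).
Proof. by apply: (multipleB Phi_gt1); [apply: multiple1|apply: multiple_qvarX]. Qed.

Lemma multiple_1subqXV i : ~~ (n %| i)%N -> multiple 0 (1 - qvar ^+ i)^-1.
Proof.
move=> not_ni; rewrite /qvar -tofrac1 -tofracXn -tofracB.
exact/multipleV/coprimep_1subXn_Cyclotomic.
Qed.

Lemma multiple_qpochV k : (k < n)%N -> multiple 0 (qpoch qvar k)^-1.
Proof.
move=> lt_kn; rewrite /qpoch -prodfV. apply: multiple_prod => i.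
apply: multiple_1subqXV; rewrite gtnNdvd //.
exact: leq_ltn_trans (ltn_ord i) lt_kn.
Qed.

Lemma multiple_1subqn : multiple 1 (1 - qvar ^+ n).
Proof.
have n_div : n \in divisors n by rewrite -dvdn_divisors.
have := prod_Cyclotomic n_gt0.
rewrite (bigD1_seq n) ?divisors_uniq //= => def_Xn.
exists (- \prod_(d <- divisors n | d != n) 'Phi_d), 1.
rewrite coprime1p tofrac1 divr1 expr1 -tofracM mulrN def_Xn opprB.
by rewrite tofracB tofracXn tofrac1.
Qed.

Lemma multiple_1subqMn m : multiple 1 (1 - qvar ^+ (m * n)).
Proof.
elim: m => [|m IHm]; first by rewrite expr0 subrr; apply: multiple0.
have -> : 1 - qvar ^+ (m.+1 * n)
        = (1 - qvar ^+ n) + qvar ^+ n * (1 - qvar ^+ (m * n)).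
  by rewrite mulSn exprD mulrBr mulr1 addrA subrK.
apply: (multipleD Phi_gt1 multiple_1subqn).
exact: (multipleMl (multiple_qvarX _)).
Qed.

(** First-order expansion at q^n = 1: the error added at each step, (1 - q^n)(1 - q^(mn)), is a
    product of two multiples of Phi_n. *)
Lemma multiple_1subqMn_linear m :
  multiple 2 (1 - qvar ^+ (m * n) - m%:R * (1 - qvar ^+ n)).
Proof.
elim: m => [|m IHm].
  by rewrite expr0 subrr mul0r subrr; apply: multiple0.
have -> : 1 - qvar ^+ (m.+1 * n) - m.+1%:R * (1 - qvar ^+ n)
        = (1 - qvar ^+ (m * n) - m%:R * (1 - qvar ^+ n))
          - (1 - qvar ^+ n) * (1 - qvar ^+ (m * n)).
  rewrite mulSn exprD -natr1.
  by move: (qvar ^+ n) (qvar ^+ (m * n)) m%:R => u v w; ring.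
apply: (multipleB Phi_gt1 IHm).
exact: (multipleM multiple_1subqn (multiple_1subqMn m)).
Qed.

(** Putting q^n = 1 reduces the quotient to -q^(-2(i+1)) (1 - q^(i+j+2)), that is, q^(j-i) (1 -
    q^(-(i+j+2))); the exponent n - j - 2 - i is the nonnegative representative of -(i+j+2). *)
Lemma multiple_term_factor c b i j :
    (0 < c)%N -> (i < j)%N -> (j < n %/ 2)%N ->
  multiple 1 ((1 - qvar ^+ (2 * (c * n - i.+1)))
                  * (1 - qvar ^+ (2 * (b * n) + j.+1 + i.+1))
                  / (1 - qvar ^+ (2 * (b * n + i.+1)))
              - qvar ^+ (j - i) * (1 - qvar ^+ (n - j.+2 - i))).
Proof.
move=> c_gt0 lt_ij le_jn.
have lt_2in : (2 * i.+1 < n)%N by lia.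
have not_n : ~~ (n %| 2 * (b * n + i.+1))%N.
  exact: ndvdn_double_addn.
have nz : 1 - qvar ^+ (2 * (b * n + i.+1)) != 0.
  by rewrite -(prednK (_ : 0 < 2 * (b * n + i.+1))%N) ?qvar_nroot // muln_gt0 addnS.
set p := qvar ^+ (j - i); set r := qvar ^+ (n - j.+2 - i).
set s := qvar ^+ (2 * b * n); set t := qvar ^+ (2 * i.+1).
set v := qvar ^+ ((2 * c).-1 * n).
have e1 : qvar ^+ (2 * (c * n - i.+1)) = p * r * v.
  by rewrite -!exprD; congr (_ ^+ _); nia.
have e2 : qvar ^+ (2 * (b * n) + j.+1 + i.+1) = p * s * t.
  by rewrite -!exprD; congr (_ ^+ _); lia.
have e3 : qvar ^+ (2 * (b * n + i.+1)) = s * t.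
  by rewrite -!exprD; congr (_ ^+ _); lia.
have e4 : qvar ^+ ((2 * b).+1 * n) = p * r * t * s.
  by rewrite -!exprD; congr (_ ^+ _); lia.
have e5 : qvar ^+ ((2 * c + 2 * b) * n) = v * (p * r * t) * s.
  by rewrite -!exprD; congr (_ ^+ _); nia.
have -> : (1 - qvar ^+ (2 * (c * n - i.+1))) * (1 - qvar ^+ (2 * (b * n) + j.+1 + i.+1))
    / (1 - qvar ^+ (2 * (b * n + i.+1))) - p * (1 - r)
  = ((1 - qvar ^+ ((2 * b).+1 * n)) + p * r * (1 - v)
      - p * (1 - qvar ^+ ((2 * c + 2 * b) * n))) / (1 - qvar ^+ (2 * (b * n + i.+1))).
  move: nz; rewrite e1 e2 e3 e4 e5.
  by move: p r s t v {e1 e2 e3 e4 e5} => p r s t v nz; apply: term_factor_eq.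
rewrite mulrC; apply: multipleMl; first exact: multiple_1subqXV.
apply: (multipleB Phi_gt1).
  apply: (multipleD Phi_gt1); first exact: multiple_1subqMn.
  apply: multipleMl; last exact: multiple_1subqMn.
  exact: (multipleMl (multiple_qvarX _) (multiple_qvarX _)).
exact: (multipleMl (multiple_qvarX _) (multiple_1subqMn _)).
Qed.

Lemma multiple_lucas_coef j :
  (j < n %/ 2)%N -> multiple 0 (lucas_coef qvar n j).
Proof.
move=> lt_jn; apply: multipleMl; last by apply: multiple_qpochV; lia.
apply: multipleMl; last by apply: multiple_prod => i; apply: multiple_1subqX.
exact: (multipleMl (multiple_signr _) (multiple_qvarX _)).
Qed.

Lemma term_coef_congr c b j : (0 < c)%N -> (j < n %/ 2)%N ->
  multiple 1 ((-1) ^+ j.+1 * term_coef qvar (c * n) (b * n) j - lucas_coef qvar n j).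
Proof.
move=> c_gt0 lt_jn.
(* The power q^(j(j+1)/2) is spread as the product of the q^(j-i), so that the two products can be
   compared factor by factor. *)
have -> : lucas_coef qvar n j = (-1) ^+ j.+1 *
    ((\prod_(i < j) (qvar ^+ (j - i) * (1 - qvar ^+ (n - j.+2 - i))))
      / qpoch qvar j.+1).
  rewrite /lucas_coef big_split -!mulrA; congr (_ * (_ * _)).
  rewrite prodrXr; congr (_ ^+ _).
  elim: {lt_jn}j => [|j IHj]; first by rewrite big_ord0.
  by rewrite big_ord_recl subn0 binS bin1 addnC IHj.
rewrite -mulrBr -mulrBl; apply: (multipleMl (multiple_signr _)).
rewrite mulrC; apply: multipleMl; first by apply: multiple_qpochV; lia.
apply: (multiple_prodB Phi_gt1) => i; last by apply: multiple_term_factor.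
  apply: multipleMl; last apply: multiple_1subqXV.
    exact: (multipleMl (multiple_1subqX _) (multiple_1subqX _)).
  by apply: ndvdn_double_addn; have := ltn_ord i; lia.
exact: (multipleMl (multiple_qvarX _) (multiple_1subqX _)).
Qed.
End Congruences.

(** * The sum T_0' modulo the square of Phi_n *)

Theorem theorem1p4 (a b n : nat) (a_gt0 : (0 < a)%N) (b_gt0 : (0 < b)%N)
    (n_gt0 : (0 < n)%N) (b_lt_a : (b < a)%N) :
  eqmod_sqr 'Phi_n (T0' a b n)
    ((-1) ^+ (a * n - b * n) * qbinom (qvar ^+ 2) (a * n) (b * n)
      * (1 - 2%:R * (a%:R - b%:R) * (1 - theta n))).
Proof.
have Phi_gt1 := size_Cyclotomic_gt1 n_gt0.
have le_bn_an : (b * n <= a * n)%N by rewrite leq_mul2r (ltnW b_lt_a) orbT.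
have c_gt0 : (0 < a - b)%N by rewrite subn_gt0.
rewrite -natrB ?(ltnW b_lt_a) // /T0' theta_qlucas // -mulnBl.
have le_jC j : (j <= n %/ 2 -> j <= (a - b) * n)%N by nia.
set C := ((a - b) * n)%N; set B := qbinom _ _ (b * n).
have term0 : qbinom (qvar ^+ 2) (a * n) C = B.
  by rewrite /C mulnBl qbinom_sub // => i; rewrite -exprM mulnS qvar_nroot.
have -> : \sum_(C - n %/ 2 <= k < C.+1) (-1) ^+ k * qbinom (qvar ^+ 2) (a * n) k
            * qbinom qvar (2 * a * n - 2 * k) (C - k)
  = (-1) ^+ C * B * (1 + \sum_(j < n %/ 2)
      (1 - qvar ^+ (2 * C)) * ((-1) ^+ j.+1 * term_coef qvar C (b * n) j)).
  rewrite -{1}[(C - n %/ 2)%N]add0n big_addn.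
  have -> : (C.+1 - (C - n %/ 2) = (n %/ 2).+1)%N by have := le_jC _ (leqnn _); lia.
  rewrite big_mkord (reindex_inj rev_ord_inj) big_ord_recl /=.
  have -> : ((n %/ 2).+1 - 1 + (C - n %/ 2) = C)%N by have := le_jC _ (leqnn _); lia.
  rewrite subnn qbinom0 term0 mulr1 mulrDr mulr1; congr (_ + _).
  rewrite mulr_sumr; apply: eq_bigr => j _; rewrite /bump /=.
  have lt_jC := le_jC _ (ltn_ord j).
  have -> : ((n %/ 2).+1 - (1 + j).+1 + (C - n %/ 2) = C - j.+1)%N.
    by have := le_jC _ (leqnn _); have := ltn_ord j; lia.
  rewrite subKn // -[(2 * a * n)%N]mulnA -[LHS]mulrA.
  rewrite /C mulnBl T0'_term; [|exact: qvar_nroot|by rewrite /C mulnBl in lt_jC; lia].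
  rewrite -/B -mulnBl -/C.
  (* Factoring out (-1)^C leaves the sign (-1)^(j+1) on the ratio, where [lucas_coef] carries it
     too. *)
  have -> : (-1) ^+ C = (-1) ^+ (C - j.+1) * (-1) ^+ j.+1 :> ratfun.
    by rewrite -exprD subnK.
  have : (-1) ^+ j.+1 * (-1) ^+ j.+1 = 1 :> ratfun.
    by rewrite -expr2 sqrr_sign.
  set u := (-1) ^+ j.+1; set w := (-1) ^+ (C - j.+1); set t := term_coef _ _ _ _.
  move=> uu; have -> (v d : ratfun) : w * u * v * (d * (u * t)) =
    u * u * (w * (v * (d * t))).
    by ring.
  by rewrite uu mul1r.
rewrite /eqmod_sqr -/(multiple 'Phi_n 2 _) -mulrBr.
apply: multipleMl.
  apply: (multipleMl (multiple_signr _ _)).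
  apply: (multiple_qbinom Phi_gt1) => [i|]; last exact: multiple_qvarX.
  by rewrite -exprM mulnS qvar_nroot.
have -> (x y z w : ratfun) : 1 + x - (1 - y * z * (1 - (1 + w))) = x - y * z * w.
  by rewrite !opprD addrA; ring.
rewrite !mulr_sumr -sumrB; apply: (multiple_sum Phi_gt1) => j.
set t := _ * term_coef _ _ _ _; set l := lucas_coef _ _ _.
(* The first summand is a product of two multiples of Phi_n; in the second, l lies in the local ring
   and the bracket is a multiple of the square, by linearization. *)
have -> : (1 - qvar ^+ (2 * C)) * t - 2%:R * (a - b)%:R * ((1 - qvar ^+ n) * l)
  = (1 - qvar ^+ (2 * C)) * (t - l)
    + l * ((1 - qvar ^+ (2 * C)) - (2 * (a - b))%:R * (1 - qvar ^+ n)).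
  rewrite natrM; move: (qvar ^+ _) (qvar ^+ _) (2%:R * _) t l => u v w t l; ring.
rewrite /C mulnA; apply: (multipleD Phi_gt1).
  apply: (multipleM (multiple_1subqMn n_gt0 _)).
  exact: term_coef_congr.
apply: multipleMl; last exact: multiple_1subqMn_linear.
exact: multiple_lucas_coef.
Qed.
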